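(* Let $\Delta$ be a nice diagram with $n$ nodes and let $(\mathcal A,D,A)$ be a nondiagonal triple on $\Delta$, where $(\lambda_1,\dotsc,\lambda_n)$ denotes the diagonal of $D$. Let $X=(x_I)$ be a real vector, indexed by the rows $I$ of the root matrix $M_\Delta$, such that \[\frac1{2\operatorname{tr}D}\bigl({}^tM_\Delta X\bigr)=\Bigl[-1-\sum_{(i,j)\in\mathcal A}A^i_j\Bigr]+\sum_{(i,j)\in\mathcal A}A^i_j(e_i-e_j)+(\lambda_1,\dotsc,\lambda_n)\] in $\mathbb R^n$. Suppose $\epsilon\in\{\pm1\}^n$ satisfies \[M_{\Delta,2}(\operatorname{logsign}\epsilon)=\operatorname{logsign}X,\qquad \epsilon_i/\epsilon_j=\operatorname{sign}(A^i_j\operatorname{tr}D)\ \text{ for all }(i,j)\in\mathcal A.\] Suppose $\mathfrak g$ is a nice Lie algebra with nice diagram $\Delta$ whose structure constants satisfy $c_I^2=|x_I|$ for every $I$, and such that $D$ (viewed as an endomorphism of $\mathfrak g\cong\mathbb R^n$ through the nice basis) is a derivation of $\mathfrak g$. Then the diagonal metric $\epsilon_1e^1\otimes e^1+\dotsb+\epsilon_ne^n\otimes e^n$ on $\mathfrak g$ satisfies \[\operatorname{Ric}=-\operatorname{tr}((D^s)^2)\operatorname{Id}-\tfrac12[D,D^*]+(\operatorname{tr}D)D^s,\qquad \operatorname{tr}(\operatorname{ad}v\circ D^* )=0\ \text{ for all } v\in\mathfrak g.\]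
   Context: All Lie algebras are real, finite-dimensional; nice Lie algebras are nilpotent. A metric on a Lie algebra is a nondegenerate symmetric bilinear form of any signature; it determines a left-invariant pseudo-Riemannian metric on a Lie group with that Lie algebra, with Ricci operator $\operatorname{Ric}\colon\mathfrak g\to\mathfrak g$. $D^*$ is the metric adjoint of $D$, $D^s=\frac12(D+D^* )$, $[D,D^*]=DD^*-D^*D$. The endomorphism $e^i\otimes e_j$ maps $v$ to $e^i(v)e_j$. Nice Lie algebras and nice diagrams. A basis $e_1,\dotsc,e_n$ of a Lie algebra with dual basis $e^1,\dotsc,e^n$ is a nice basis if each $[e_i,e_j]$ is a multiple of a single basis element and each $e_i\lrcorner de^j=de^j(e_i,\cdot)$ is a multiple of a single dual basis element. A nice Lie algebra is a (nilpotent) Lie algebra with a fixed nice basis. Its nice diagram is the labeled directed acyclic graph with set of nodes $\{1,\dotsc,n\}$ having an arrow $i\to k$ with label $j$, written $i\xrightarrow{j}k$, exactly when $[e_i,e_j]=c_{ijk}e_k$ with $c_{ijk}\neq0$. Thus $i\xrightarrow{j}k$ is an arrow if and only if $j\xrightarrow{i}k$ is. Here $\Delta$ may be taken to be a labeled graph arising in this way; $N(\Delta)=\{1,\dotsc,n\}$ denotes its set of nodes. Root matrix. $M_\Delta$ is the matrix with $n$ columns having one row $I$ for each pair of arrows $i\xrightarrow{j}k$, $j\xrightarrow{i}k$; this row has $-1$ in positions $i$ and $j$, $+1$ in position $k$ and $0$ elsewhere. If the row $I$ corresponds to $i\xrightarrow{j}k$, then $c_I$ denotes the structure constant $c_{ijk}$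 (defined up to sign by $I$). $M_{\Delta,2}$ is the reduction of $M_\Delta$ modulo $2$. For a nonzero real $x$, $\operatorname{logsign}x\in\mathbb Z/2$ is $1$ if $x<0$ and $0$ if $x>0$; for vectors it is applied entrywise. For $x\in\mathbb R$, $[x]$ denotes the vector in $\mathbb R^n$ all of whose entries equal $x$, and $e_i$ denotes also the $i$-th standard basis vector of $\mathbb R^n$. Nondiagonal triple. Let $\mathcal A$ be a nonempty subset of $N(\Delta)\times N(\Delta)$, $D\colon\mathbb R^n\to\mathbb R^n$ a linear map, and $A\colon\mathcal A\to\mathbb R\setminus\{0\}$ a function, with $A^i_j:=A(i,j)$. These data form a nondiagonal triple on $\Delta$ if: (N1) $i\neq j$ whenever $(i,j)\in\mathcal A$; (N2) whenever $(i,j),(i',j')$ are distinct elements of $\mathcal A$, the elements $i,j,i',j'$ are pairwise distinct; (N3) if $(i,j)\in\mathcal A$, there is no arrow $i\xrightarrow{k}j$ for any $k$; (N4) denoting by $(\lambda_1,\dotsc,\lambda_n)$ the diagonal elements of $D$, for every $\mu\in\ker M_\Delta$, $\sum_i\lambda_i\mu_i=\bigl(1+\sum_{(i,j)\in\mathcal A}A^i_j\bigr)\sum_i\mu_i+\sum_{(i,j)\in\mathcal A}A^i_j(\mu_j-\mu_i)$; (N5) $\lambda_1+\dotsb+\lambda_n=\lambda_i-\lambda_j$ whenever $(i,j)\in\mathcal A$; (N6) $D=\lambda_1e^1\otimes e_1+\dotsb+\lambda_ne^n\otimes e_n+\sum_{(i,j)\in\mathcal A}a_{ji}e^i\otimes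 e_j$, where $a_{ji}^2=|2A^i_j\operatorname{tr}D|\neq0$ and $(\lambda_1,\dotsc,\lambda_n)\in\ker M_\Delta$. *)

(* Defs.v *)
From HB Require Import structures.
From mathcomp Require Import all_boot all_order all_algebra.
From mathcomp Require Import sesquilinear reals ring.

Set Implicit Arguments.
Unset Strict Implicit.
Unset Printing Implicit Defensive.

Import Order.TTheory GRing.Theory Num.Theory.
Local Open Scope ring_scope.

Lemma linfunE (R : fieldType) (U V : vectType R) (f : U -> V) :
  linear f -> linfun f =1 f.
Proof.
move=> lin_f x; pose f' : {linear U -> V} := HB.pack f
  (GRing.isSemilinear.Build _ _ _ _ f (GRing.semilinear_linear lin_f)).
exact: (lfunE f' x).
Qed.

HB.mixin Record Vector_isLie (R : fieldType) V of Vector R V := {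
  lie : V -> V -> V;
  lie_bilinear : bilinear_for *:%R *:%R lie;
  liexx : forall x, lie x x = 0;
  jacobi : forall x y z,
    lie x (lie y z) + lie y (lie z x) + lie z (lie x y) = 0
}.

#[short(type="lieAlgType")]
HB.structure Definition LieAlgebra (R : fieldType) :=
  {V of Vector R V & Vector_isLie R V}.

HB.instance Definition _ (R : fieldType) (g : lieAlgType R) :=
  bilinear_isBilinear.Build R g g g *:%R *:%R (@lie R g) (@lie_bilinear R g).

Definition ad (R : fieldType) (g : lieAlgType R) (x : g) : 'End(g) :=
  linfun (lie x).

Lemma adE (R : fieldType) (g : lieAlgType R) (x y : g) : ad x y = lie x y.
Proof. by apply: linfunE => a u v; rewrite linearPr. Qed.

Lemma lieC (R : fieldType) (g : lieAlgType R) (x y : g) : lie x y = - lie y x.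
Proof.
apply/eqP; rewrite -subr_eq0 opprK; have := liexx (x + y).
by rewrite linearDl !linearDr /= !liexx add0r addr0 => ->.
Qed.

Fixpoint lower_central (R : fieldType) (g : lieAlgType R) (k : nat) :
    {vspace g} :=
  if k is k'.+1 then
    <<[seq lie x y | x <- vbasis {:g}, y <- vbasis (lower_central g k')]>>%VS
  else fullv.

Definition lie_nilpotent (R : fieldType) (g : lieAlgType R) : Prop :=
  exists k, lower_central g k = 0%VS.

Definition is_derivation (R : fieldType) (g : lieAlgType R) (f : 'End(g)) :
    Prop :=
  forall x y, f (lie x y) = lie (f x) y + lie x (f y).

(* The differential of a one-form [a], [da (x, y) = - a [x, y]]. *)
Definition dform (R : fieldType) (g : lieAlgType R) (a : g -> R) (x y : g) : R :=
  - a (lie x y).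

Definition nice_basis (R : fieldType) (g : lieAlgType R) (n : nat)
    (e : n.-tuple g) : Prop :=
  [/\ basis_of {:g} e,
      forall i j : 'I_n, exists (k : 'I_n) (c : R), lie e`_i e`_j = c *: e`_k
    & forall i j : 'I_n, exists (k : 'I_n) (c : R),
        forall v, dform (coord e j) e`_i v = c * coord e k v].

Definition structc (R : fieldType) (g : lieAlgType R) (n : nat)
    (e : n.-tuple g) (i j k : 'I_n) : R := coord e k (lie e`_i e`_j).

(* A labeled directed graph with set of nodes ['I_n] and labels in ['I_n] is
   given by its set of arrows; the triple [(i, j, k)] is the arrow from [i] to
   [k] with label [j]. *)
Definition arrow (n : nat) : finType := ('I_n * 'I_n * 'I_n)%type.

Definition nice_diagram (R : fieldType) (g : lieAlgType R) (n : nat)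
    (e : n.-tuple g) : {set arrow n} :=
  [set t : arrow n | let: (i, j, k) := t in
    (structc e i j k != 0) && (lie e`_i e`_j == structc e i j k *: e`_k)].

Definition is_nice_diagram (R : fieldType) (n : nat) (Delta : {set arrow n}) :
    Prop :=
  exists (g : lieAlgType R) (e : n.-tuple g),
    [/\ lie_nilpotent g, nice_basis e & nice_diagram e = Delta].

(* Arrows come in pairs [(i, j, k)], [(j, i, k)] with [i != j]; the one with
   [i < j] represents the pair. *)
Definition root_rows (n : nat) (Delta : {set arrow n}) : {set arrow n} :=
  [set t in Delta | (t.1.1 < t.1.2)%N].

Definition root_arrow (n : nat) (Delta : {set arrow n})
  (I : 'I_#|root_rows Delta|) : arrow n := enum_val I.

Definition root_int (n : nat) (Delta : {set arrow n}) :
    'M[int]_(#|root_rows Delta|, n) :=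
  \matrix_(I, l) let: (i, j, k) := root_arrow I in
    if (l == i) || (l == j) then -1 else if l == k then 1 else 0.

Definition root_matrix (R : pzRingType) (n : nat) (Delta : {set arrow n}) :
    'M[R]_(#|root_rows Delta|, n) := map_mx intr (root_int Delta).

Definition root_matrix2 (n : nat) (Delta : {set arrow n}) :
  'M['F_2]_(#|root_rows Delta|, n) := root_matrix 'F_2 Delta.

Definition logsign (R : realDomainType) (x : R) : 'F_2 :=
  if x < 0 then 1 else 0.

Definition row_structc (R : fieldType) (g : lieAlgType R) (n : nat)
    (e : n.-tuple g) (Delta : {set arrow n}) (I : 'I_#|root_rows Delta|) : R :=
  let: (i, j, k) := root_arrow I in structc e i j k.

(* Linear maps of R^n are matrices acting on column vectors, so that [D j i] is
   the coefficient of [e_j] in [D e_i]. *)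
Definition diagonal (R : pzRingType) (n : nat) (D : 'M[R]_n) : 'cV[R]_n :=
  \col_i D i i.

(* The endomorphism [e^i \otimes e_j], mapping [v] to [e^i(v) e_j]. *)
Definition dyad (R : pzRingType) (n : nat) (i j : 'I_n) : 'M[R]_n :=
  delta_mx j i.

(* [A] is a function on [calA]; its values elsewhere are irrelevant. *)
Record nondiagonal_triple (R : realFieldType) (n : nat) (Delta : {set arrow n})
    (calA : {set 'I_n * 'I_n}) (D : 'M[R]_n) (A : 'I_n -> 'I_n -> R) : Prop :=
  NondiagonalTriple {
  triple_nonempty : calA != set0;
  triple_A_neq0 : forall i j, (i, j) \in calA -> A i j != 0;
  triple_irrefl : forall i j, (i, j) \in calA -> i != j;
  triple_disjoint : forall i j i' j', (i, j) \in calA -> (i', j') \in calA ->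
    (i, j) <> (i', j') -> uniq [:: i; j; i'; j'];
  triple_no_arrow : forall i j, (i, j) \in calA ->
    forall k, (i, k, j) \notin Delta;
  triple_kernel : forall mu : 'cV[R]_n, root_matrix R Delta *m mu = 0 ->
    \sum_i diagonal D i 0 * mu i 0 =
      (1 + \sum_(p in calA) A p.1 p.2) * \sum_i mu i 0
      + \sum_(p in calA) A p.1 p.2 * (mu p.2 0 - mu p.1 0);
  triple_weight : forall i j, (i, j) \in calA ->
    \sum_k diagonal D k 0 = diagonal D i 0 - diagonal D j 0;
  triple_shape : exists a : 'I_n -> 'I_n -> R,
    [/\ D = \sum_i diagonal D i 0 *: dyad R i i
            + \sum_(p in calA) a p.2 p.1 *: dyad R p.1 p.2,
        forall i j, (i, j) \in calA ->
          a j i ^+ 2 = `|2 * A i j * \tr D| /\ `|2 * A i j * \tr D| != 0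
      & root_matrix R Delta *m diagonal D = 0]
}.

(* A linear map of R^n as an endomorphism, through the basis [e]. *)
Definition endo_of (R : fieldType) (V : vectType R) (n : nat) (e : n.-tuple V)
    (D : 'M[R]_n) : 'End(V) :=
  linfun (fun v => \sum_i coord e i v *: \sum_j D j i *: e`_j).

Lemma endo_ofE (R : fieldType) (V : vectType R) (n : nat) (e : n.-tuple V)
    (D : 'M[R]_n) (i : 'I_n) :
  basis_of {:V} e -> endo_of e D e`_i = \sum_j D j i *: e`_j.
Proof.
move=> e_basis; rewrite linfunE => [|c u v].
  rewrite (bigD1 i) //= [X in _ + X]big1 => [|k /negPf ki].
    by rewrite coord_free ?(basis_free e_basis) // eqxx scale1r addr0.
  by rewrite coord_free ?(basis_free e_basis) // eq_sym ki scale0r.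
rewrite scaler_sumr -big_split; apply: eq_bigr => k _ /=.
by rewrite linearP scalerDl scalerA.
Qed.

Definition lftr (R : fieldType) (V : vectType R) (f : 'End(V)) : R :=
  \tr (passmx.mxof (vbasis {:V}) (vbasis {:V}) f).

Lemma lftr_linear (R : fieldType) (V : vectType R) :
  GRing.linear_for *%R (@lftr R V).
Proof. by move=> c f h; rewrite /lftr passmx.mxof_linear mxtraceD mxtraceZ. Qed.

Section Metric.
Variables (R : fieldType) (V : vectType R) (m : {symmetric V}).

Let b := vbasis {:V}.

Definition gram : 'M[R]_(\dim {:V}) := \matrix_(i, j) m b`_i b`_j.

(* The vector metrically dual to a linear form; see [sharpP]. *)
Definition sharp (a : V -> R) : V :=
  \sum_i \sum_j (invmx gram i j * a b`_i) *: b`_j.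

(* The metric adjoint; see [adjointP]. *)
Definition adjoint (f : 'End(V)) : 'End(V) :=
  linfun (fun y => sharp (fun x => m (f x) y)).

Lemma metricC x y : m x y = m y x.
Proof. by rewrite hermC expr0 mul1r. Qed.

Lemma nondegP : nondegenerate m ->
  forall u v, (forall w, m u w = m v w) -> u = v.
Proof.
move=> /eqP m0 u v uv; apply/eqP; rewrite -subr_eq0 -memv0 -m0.
by apply/mem_orthovP => w _; rewrite linearBl /= uv subrr.
Qed.

Lemma gram_unit : nondegenerate m -> gram \in unitmx.
Proof.
move=> m0; rewrite -row_free_unit; apply: inj_row_free => r r0.
pose v := \sum_i r 0 i *: b`_i.
have v0 : v = 0.
  apply: (nondegP m0) => w; rewrite [w](coord_vbasis (memvf w)) !linear_sumr.
  apply: eq_bigr => j _; rewrite !linearZr_LR linear0l /v linear_sumlz /=.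
  have /rowP/(_ j) := r0; rewrite !mxE => rj.
  rewrite mulr0 (eq_bigr (fun i => r 0 i * gram i j)) ?rj ?mulr0 // => i _.
  by rewrite linearZl_LR mxE.
have /freeP b_free := basis_free (vbasisP {:V}).
by apply/rowP => i; rewrite mxE (b_free (fun i => r 0 i) v0 i).
Qed.

Lemma sharpP (a : V -> R) w : nondegenerate m ->
  GRing.linear_for *%R a -> m (sharp a) w = a w.
Proof.
move=> m0 lin_a; pose a' : {scalar V} := HB.pack a
  (GRing.isSemilinear.Build _ _ _ _ a (GRing.semilinear_linear lin_a)).
have -> : a = a' by [].
rewrite [w](coord_vbasis (memvf w)) linear_sumr linear_sum.
apply: eq_bigr => k _; rewrite linearZr_LR linearZ /=; congr (_ * _).
transitivity (\sum_(i < \dim {:V}) a b`_i * (invmx gram *m gram) i k).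
  rewrite linear_sumlz; apply: eq_bigr => i _.
  rewrite linear_sumlz mxE mulr_sumr; apply: eq_bigr => j _.
  by rewrite linearZl_LR mxE /=; ring.
rewrite (mulVmx (gram_unit m0)) (bigD1 k) //= big1 => [|i /negPf ik].
  by rewrite mxE eqxx mulr1 addr0.
by rewrite mxE ik mulr0.
Qed.

Lemma adjointP (f : 'End(V)) x y :
  nondegenerate m -> m (f x) y = m x (adjoint f y).
Proof.
move=> m0; have lin_a z : GRing.linear_for *%R (fun x => m (f x) z).
  by move=> c u v; rewrite linearP linearPl.
rewrite [RHS]metricC linfunE ?sharpP // => c u v.
apply: (nondegP m0) => w.
by rewrite linearPl /= !sharpP //= linearPr.
Qed.

Definition sympart (f : 'End(V)) : 'End(V) := 2^-1 *: (f + adjoint f).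

End Metric.

Definition lfcomm (R : fieldType) (V : vectType R) (f h : 'End(V)) : 'End(V) :=
  ((f \o h)%VF - (h \o f)%VF).

Section Curvature.
Variables (R : fieldType) (g : lieAlgType R) (m : {symmetric g}).

(* The Levi-Civita connection of the left-invariant metric, on left-invariant
   vector fields, by the Koszul formula; see [levi_civitaP]. *)
Definition levi_civita (x y : g) : g :=
  sharp m (fun z => 2^-1 * (m (lie x y) z - m (lie y z) x + m (lie z x) y)).

Lemma koszulP x y z : nondegenerate m -> m (levi_civita x y) z =
  2^-1 * (m (lie x y) z - m (lie y z) x + m (lie z x) y).
Proof.
move=> m0; rewrite /levi_civita sharpP // => c u v.
by rewrite !(linearPl, linearPr) /=; ring.
Qed.

(* It is the unique torsion-free metric connection. *)
Lemma levi_civitaP (nabla : g -> g -> g) :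
  nondegenerate m -> (2 : R) != 0 ->
  (forall x y, nabla x y - nabla y x = lie x y) /\
  (forall x y z, m (nabla x y) z + m y (nabla x z) = 0)
  <-> (forall x y, nabla x y = levi_civita x y).
Proof.
move=> m0 two0; split=> [[tf mc] x y | lc].
  apply: (nondegP m0) => z; rewrite koszulP // -!tf !linearBl /=.
  have := mc x y z; have := mc y z x; have := mc z x y.
  rewrite (metricC m y) (metricC m z) (metricC m x) => h1 h2 h3.
  apply: (mulfI two0); rewrite mulVKf //.
  have -> : m (nabla x z) y = - m (nabla x y) z.
    by apply/eqP; rewrite -addr_eq0 addrC h3.
  have -> : m (nabla y x) z = - m (nabla y z) x.
    by apply/eqP; rewrite -addr_eq0 addrC h2.
  have -> : m (nabla z y) x = - m (nabla z x) y.
    by apply/eqP; rewrite -addr_eq0 addrC h1.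
  by ring.
split=> [x y | x y z]; rewrite !lc.
  apply: (nondegP m0) => z; rewrite linearBl /= !koszulP //.
  rewrite (lieC y x) (lieC x z) (lieC z y) !linearNl /=.
  by apply: (mulfI two0); rewrite mulrBr !mulVKf //; ring.
rewrite (metricC m y) !koszulP // -mulrDr.
rewrite (lieC z y) (lieC x z) (lieC y x) !linearNl /=.
by rewrite -[RHS](mulr0 2^-1); congr (_ * _); ring.
Qed.

Lemma levi_civita_linear_l y : nondegenerate m -> linear (levi_civita^~ y).
Proof.
move=> m0 c u v; apply: (nondegP m0) => z.
by rewrite linearPl /= !koszulP // !(linearPl, linearPr) /=; ring.
Qed.

Lemma levi_civita_linear_r x : nondegenerate m -> linear (levi_civita x).
Proof.
move=> m0 c u v; apply: (nondegP m0) => z.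
by rewrite linearPl /= !koszulP // !(linearPl, linearPr) /=; ring.
Qed.

Definition curvature (x y z : g) : g :=
  levi_civita x (levi_civita y z) - levi_civita y (levi_civita x z)
  - levi_civita (lie x y) z.

Definition ricci_form (y z : g) : R :=
  lftr (linfun (fun x => curvature x y z)).

Lemma curvature_linear : nondegenerate m ->
  [/\ forall y z, linear (fun x => curvature x y z),
      forall x z, linear (fun y => curvature x y z)
    & forall x y, linear (curvature x y)].
Proof.
move=> m0; have lcl z := levi_civita_linear_l z m0.
have lcr z := levi_civita_linear_r z m0.
have lin3 (c : R) (a1 a2 b1 b2 d1 d2 : g) :
    (c *: a1 + a2) - (c *: b1 + b2) - (c *: d1 + d2) =
    c *: (a1 - b1 - d1) + (a2 - b2 - d2).
  by rewrite !scalerBr !opprD [X in X + _ = _]addrACA [LHS]addrACA.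
split=> [y z c u v | x z c u v | x y c u v];
  by rewrite /curvature ?(linearPl, linearPr) /= !(lcl, lcr) lin3.
Qed.

Lemma ricci_form_linear : nondegenerate m ->
  (forall z, GRing.linear_for *%R (ricci_form^~ z)) /\
  (forall y, GRing.linear_for *%R (ricci_form y)).
Proof.
move=> /curvature_linear[l1 l2 l3]; split=> [z c u v | y c u v];
  rewrite /ricci_form -lftr_linear; congr lftr;
  by apply/lfunP => x; rewrite add_lfunE scale_lfunE !linfunE // (l2, l3).
Qed.

(* See [ricciP]. *)
Definition ricci : 'End(g) := linfun (fun y => sharp m (ricci_form y)).

Lemma ricciP y z : nondegenerate m -> m (ricci y) z = ricci_form y z.
Proof.
move=> m0; have [l1 l2] := ricci_form_linear m0.
rewrite linfunE ?sharpP // => c u v; apply: (nondegP m0) => w.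
by rewrite linearPl /= !sharpP // l1.
Qed.

End Curvature.

Definition diag_metric (R : fieldType) (V : vectType R) (n : nat)
    (e : n.-tuple V) (eps : 'cV[R]_n) (x y : V) : R :=
  \sum_i eps i 0 * coord e i x * coord e i y.

Section DiagMetric.
Variables (R : fieldType) (V : vectType R) (n : nat) (e : n.-tuple V).
Variable eps : 'cV[R]_n.

Fact diag_metric_bilinear :
  bilinear_for *%R (idfun \; *%R) (diag_metric e eps).
Proof.
split=> u a x y; rewrite /diag_metric /= mulr_sumr -big_split;
  by apply: eq_bigr => i _ /=; rewrite linearP /=; ring.
Qed.

HB.instance Definition _ := bilinear_isBilinear.Build R V V R *%R
  (idfun \; *%R) (diag_metric e eps) diag_metric_bilinear.

Fact diag_metric_sym x y :
  diag_metric e eps x y = (-1) ^+ false * idfun (diag_metric e eps y x).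
Proof. by rewrite expr0 mul1r; apply: eq_bigr => i _; rewrite mulrAC. Qed.

HB.instance Definition _ := isHermitianSesquilinear.Build R V false idfun
  (diag_metric e eps) diag_metric_sym.

End DiagMetric.

Lemma diag_metric_nondegenerate (R : fieldType) (V : vectType R) (n : nat)
    (e : n.-tuple V) (eps : 'cV[R]_n) :
  basis_of {:V} e -> (forall i, eps i 0 != 0) ->
  nondegenerate (diag_metric e eps : {symmetric V}).
Proof.
move=> e_basis eps0; rewrite /nondegenerate -subv0.
apply/subvP => v /mem_orthovP v0; rewrite memv0.
rewrite (coord_basis e_basis (memvf v)) big1 // => i _.
have := v0 e`_i (memvf _); rewrite /= /diag_metric (bigD1 i) //= big1.
  move/eqP; rewrite addr0 !mulf_eq0 (negPf (eps0 i)) /=.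
  by rewrite coord_free ?(basis_free e_basis) // eqxx oner_eq0 orbF => /eqP->;
    rewrite scale0r.
move=> j /negPf ji.
by rewrite (coord_free _ _ (basis_free e_basis)) eq_sym ji mulr0.
Qed.

(* Main.v *)
(* For a nilpotent Lie algebra the Levi-Civita operators h_w : x |-> nabla_x w
   are trace-free, and torsion-freeness turns the Ricci form into
   ric (y, z) = - tr (h_z o h_y). The Killing form vanishes because a nilpotent
   algebra has no cycle e_a -> e_c -> e_a of brackets, and niceness makes Ric
   diagonal for a diagonal metric, with diagonal 1/2 tM X. The hypothesis on X
   evaluates this vector. On the other side, D = diag lambda + N with N supported on
   the matching A, so N^2 = 0, and the weight condition N5 gives
   [N, diag lambda] = (tr D) N, which cancels the off-diagonal part of
   -1/2 [D, D^*] + (tr D) D^s. Finally N4 applied to mu = lambda says sum lambda_i^2 = tr D. *)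

Require Import Defs.
From HB Require Import structures.
From mathcomp Require Import all_boot all_order all_algebra.
From mathcomp Require Import sesquilinear reals ring.

Set Implicit Arguments.
Unset Strict Implicit.
Unset Printing Implicit Defensive.

Import Order.TTheory GRing.Theory Num.Theory.
Local Open Scope ring_scope.

(** * Traces and coordinates in an arbitrary basis *)

Lemma lftr_coord (R : fieldType) (V : vectType R) (n : nat) (e : n.-tuple V)
    (f : 'End(V)) :
  basis_of {:V} e -> lftr f = \sum_i coord e i (f e`_i).
Proof.
move=> e_basis; rewrite /lftr /passmx.mxof /mxtrace.
transitivity (\sum_(i < \dim {:V}) coord (vbasis {:V}) i (f (vbasis {:V})`_i)).
  apply: eq_bigr => i _; rewrite mxE mxE; congr (coord _ _ (f _)).
  rewrite /= /passmx.vecof (bigD1 i) //= big1 => [|j /negPf ji].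
    by rewrite !mxE !eqxx scale1r addr0.
  by rewrite !mxE ji andbF scale0r.
(* Expanding each vector of [vbasis] in [e] and exchanging the sums shows that the trace does not
   depend on the basis. *)
transitivity (\sum_(i < \dim {:V}) \sum_(j < n)
    coord e j (vbasis {:V})`_i * coord (vbasis {:V}) i (f e`_j)).
  apply: eq_bigr => i _.
  rewrite {1}(coord_basis e_basis (memvf (vbasis {:V})`_i)) !linear_sum.
  by apply: eq_bigr => j _; rewrite !linearZ.
rewrite exchange_big; apply: eq_bigr => j _.
rewrite {2}(coord_vbasis (memvf (f e`_j))) linear_sum.
by apply: eq_bigr => i _; rewrite linearZ mulrC.
Qed.

Lemma coord_nth (R : fieldType) (V : vectType R) (n : nat) (e : n.-tuple V)
    (i j : 'I_n) :
  basis_of {:V} e -> coord e i e`_j = (j == i)%:R.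
Proof. by move=> /basis_free e_free; rewrite coord_free. Qed.

Lemma coord_sum (R : fieldType) (V : vectType R) (n : nat) (e : n.-tuple V)
    (i : 'I_n) (u : 'I_n -> R) :
  basis_of {:V} e -> coord e i (\sum_j u j *: e`_j) = u i.
Proof. by move=> /basis_free e_free; rewrite coord_sum_free. Qed.

Lemma lfun_basisP (R : fieldType) (V W : vectType R) (n : nat)
    (e : n.-tuple V) (f h : 'Hom(V, W)) :
  basis_of {:V} e -> (forall i : 'I_n, f e`_i = h e`_i) -> f = h.
Proof.
move=> e_basis fh; apply/lfunP => v.
rewrite (coord_basis e_basis (memvf v)) !linear_sum.
by apply: eq_bigr => i _; rewrite !linearZ /= fh.
Qed.

Lemma lftr_comm (R : fieldType) (V : vectType R) (f h : 'End(V)) :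
  lftr (f \o h)%VF = lftr (h \o f)%VF.
Proof.
have b_basis := vbasisP {:V}.
by rewrite /lftr !(passmx.mxof_comp _ _ b_basis) mxtrace_mulC.
Qed.

Lemma endo_of_apply (R : fieldType) (V : vectType R) (n : nat)
    (e : n.-tuple V) (D : 'M[R]_n) v :
  endo_of e D v = \sum_i coord e i v *: \sum_j D j i *: e`_j.
Proof.
rewrite linfunE // => c u w; rewrite scaler_sumr -big_split.
by apply: eq_bigr => i _; rewrite linearP scalerDl scalerA.
Qed.

(** * Matrices as endomorphisms, and adjoints for a diagonal metric *)

Section EndoOf.
Variables (R : fieldType) (V : vectType R) (n : nat) (e : n.-tuple V).

Lemma endo_of_linear : linear (endo_of e).
Proof.
move=> a B C; apply/lfunP => v; rewrite add_lfunE scale_lfunE !endo_of_apply.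
rewrite scaler_sumr -big_split; apply: eq_bigr => i _ /=.
rewrite scalerA mulrC -scalerA -scalerDr; congr (_ *: _).
rewrite scaler_sumr -big_split; apply: eq_bigr => j _.
by rewrite !mxE scalerDl scalerA.
Qed.

HB.instance Definition _ := GRing.isSemilinear.Build R 'M[R]_n 'End(V) _
  (endo_of e) (GRing.semilinear_linear endo_of_linear).

Hypothesis e_basis : basis_of {:V} e.

Lemma endo_of_mul (B C : 'M[R]_n) :
  endo_of e (B *m C) = (endo_of e B \o endo_of e C)%VF.
Proof.
apply: (lfun_basisP e_basis) => i.
rewrite comp_lfunE !endo_ofE // linear_sum.
under [RHS]eq_bigr => k _ do rewrite linearZ /= endo_ofE // scaler_sumr.
rewrite exchange_big; apply: eq_bigr => j _.
rewrite mxE scaler_suml; apply: eq_bigr => k _.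
by rewrite scalerA mulrC.
Qed.

Lemma endo_of1 : endo_of e 1%:M = \1%VF.
Proof.
apply: (lfun_basisP e_basis) => i; rewrite endo_ofE // id_lfunE.
rewrite (bigD1 i) //= big1 => [|j /negPf ji].
  by rewrite mxE eqxx scale1r addr0.
by rewrite mxE ji scale0r.
Qed.

Lemma lftr_endo_of (B : 'M[R]_n) : lftr (endo_of e B) = \tr B.
Proof.
rewrite (lftr_coord _ e_basis); apply: eq_bigr => i _.
by rewrite endo_ofE // coord_sum.
Qed.

Variable eps : 'cV[R]_n.
Hypothesis eps2 : forall i, eps i 0 * eps i 0 = 1.
Let m : {symmetric V} := diag_metric e eps.

Lemma eps_neq0 i : eps i 0 != 0.
Proof.
by apply/eqP => eps0; have /eqP := eps2 i; rewrite eps0 mulr0 eq_sym oner_eq0.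
Qed.

Lemma diag_metric_nondeg : nondegenerate m.
Proof. exact: diag_metric_nondegenerate e_basis eps_neq0. Qed.

Lemma diag_metric_nth v (i : 'I_n) : m v e`_i = eps i 0 * coord e i v.
Proof.
rewrite /m /= /diag_metric (bigD1 i) //= big1 => [|j /negPf ji].
  by rewrite coord_nth // eqxx mulr1 addr0.
by rewrite coord_nth // eq_sym ji mulr0.
Qed.

Lemma diag_metric_coord v (i : 'I_n) : coord e i v = eps i 0 * m v e`_i.
Proof. by rewrite diag_metric_nth mulrA eps2 mul1r. Qed.

(** With E the diagonal matrix of [eps], this is E B^T E: the transpose conjugated by the Gram
    matrix, since E is its own inverse when the signs square to 1. *)
Definition adjoint_mx (B : 'M[R]_n) : 'M[R]_n :=
  \matrix_(i, j) (eps i 0 * eps j 0 * B j i).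

Lemma adjoint_endo_of (B : 'M[R]_n) :
  adjoint m (endo_of e B) = endo_of e (adjoint_mx B).
Proof.
apply: (lfun_basisP e_basis) => j; apply: (nondegP diag_metric_nondeg) => w.
rewrite metricC -adjointP ?diag_metric_nondeg //.
rewrite (coord_basis e_basis (memvf w)) linear_sum linear_sumlz linear_sumr.
apply: eq_bigr => i _; rewrite linearZ linearZl_LR linearZr_LR; congr (_ * _).
rewrite [LHS]diag_metric_nth [RHS]diag_metric_nth /= !endo_ofE // !coord_sum //.
by rewrite mxE !mulrA eps2 mul1r.
Qed.

End EndoOf.

(** * Nilpotency, and the Ricci form as a trace *)

Section LieNilpotent.
Variables (R : fieldType) (g : lieAlgType R).
Hypothesis two0 : (2 : R) != 0.

Lemma lie_lower_central k (x y : g) :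
  y \in lower_central g k -> lie x y \in lower_central g k.+1.
Proof.
move=> yk; rewrite (coord_vbasis (memvf x)) (coord_vbasis yk).
rewrite linear_sumlz; apply: memv_suml => i _; rewrite linear_sumr.
apply: memv_suml => j _; rewrite linearZl_LR linearZr_LR /=.
apply/memvZ/memvZ/memv_span/allpairsP.
exists ((vbasis {:g})`_i, (vbasis (lower_central g k))`_j) => /=.
by split=> //; rewrite mem_nth // size_tuple.
Qed.

(** By induction [u] and [v] lie in every term of the lower central series, since each bracket
    carries one of them a step deeper onto a nonzero multiple of the other. *)
Lemma nilpotent_no_cycle (x y u v : g) (a b : R) : lie_nilpotent g ->
  lie x u = a *: v -> lie y v = b *: u -> a * b != 0 -> u = 0.
Proof.
move=> [k gk] xu yv; rewrite mulf_eq0 negb_or => /andP[a0 b0].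
suff /(_ k) [] : forall k, u \in lower_central g k /\ v \in lower_central g k.
  by rewrite gk memv0 => /eqP.
elim=> [|l [ul vl]]; first by rewrite !memvf.
have := lie_lower_central x ul; have := lie_lower_central y vl.
by rewrite xu yv !rpredZeq (negPf a0) (negPf b0).
Qed.

(** Write h_w for x |-> nabla_x w and N for nabla_y. Since [x, y] = h_y x - N x, the curvature as a
    map of x is h_{nabla_y z} - N h_z + h_z N - h_z h_y. The first term is trace-free by hypothesis,
    and so is the commutator of h_z and N. *)
Lemma ricci_form_trace (m : {symmetric g}) y z :
  nondegenerate m ->
  (forall w, lftr (linfun (fun x => levi_civita m x w)) = 0) ->
  ricci_form m y z =
    - lftr (linfun (fun x => levi_civita m x z) \o
            linfun (fun x => levi_civita m x y))%VF.
Proof.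
move=> m0 div0; pose h w := linfun (fun x => levi_civita m x w).
have hE w x : h w x = levi_civita m x w.
  by rewrite linfunE //; exact: levi_civita_linear_l.
pose N := linfun (levi_civita m y).
have NE x : N x = levi_civita m y x.
  by rewrite linfunE //; exact: levi_civita_linear_r.
have torsion x : lie x y = h y x - N x.
  have [_ /(_ (fun _ _ => erefl))[tf _]] :=
    levi_civitaP (levi_civita m) m0 two0.
  by rewrite hE NE tf.
have -> : ricci_form m y z =
    lftr (-1 *: (h z \o h y)%VF + (-1 *: (N \o h z)%VF +
          (1 *: (h z \o N)%VF + h (levi_civita m y z)))).
  rewrite /ricci_form; congr lftr; apply/lfunP => x.
  rewrite linfunE; last by case: (curvature_linear m0).
  rewrite !(add_lfunE, scale_lfunE, comp_lfunE) /curvature -(hE z (lie x y)).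
  rewrite torsion linearB /= -!NE -!hE !scaleN1r scale1r opprB.
  by rewrite [RHS]addrC -!addrA addrCA; congr (_ + _); rewrite addrCA.
rewrite !lftr_linear div0 addr0 (lftr_comm N).
by rewrite mulN1r mul1r mulN1r addNr addr0.
Qed.
End LieNilpotent.

(** * The Ricci operator of a diagonal metric on a nice basis *)

Lemma sum_antisym (R : fieldType) (I : finType) (F : I -> I -> R) :
  (2 : R) != 0 -> (forall i j, F j i = - F i j) -> \sum_i \sum_j F i j = 0.
Proof.
move=> two0 FN; apply: (mulfI two0); rewrite mulr0 mulr_natl mulr2n.
rewrite {2}exchange_big -big_split big1 // => i _.
by rewrite -big_split big1 //= => j _; rewrite FN addNr.
Qed.

Section NiceRicci.
Variables (R : fieldType) (g : lieAlgType R) (n : nat) (e : n.-tuple g).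
Hypothesis two0 : (2 : R) != 0.
Hypothesis g_nilpotent : lie_nilpotent g.
Hypothesis e_nice : nice_basis e.

Let e_basis : basis_of {:g} e. Proof. by case: e_nice. Qed.

Lemma structcC i j k : structc e j i k = - structc e i j k.
Proof. by rewrite /structc lieC linearN. Qed.

Lemma nth_basis_neq0 (i : 'I_n) : e`_i != 0.
Proof.
apply/eqP => ei0; have := coord_nth i i e_basis.
by rewrite ei0 linear0 eqxx => /eqP; rewrite eq_sym oner_eq0.
Qed.

Lemma lie_structc i j k :
  structc e i j k != 0 -> lie e`_i e`_j = structc e i j k *: e`_k.
Proof.
case: e_nice => _ /(_ i j)[l [c eij]] _; rewrite /structc eij linearZ /=.
rewrite coord_nth //; have [<- _ | _] := eqVneq l k; first by rewrite mulr1.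
by rewrite mulr0 eqxx.
Qed.

Lemma structc_target i j k k' : k != k' ->
  structc e i j k * structc e i j k' = 0.
Proof.
move=> /negPf kk'; have [-> | /lie_structc eij] := eqVneq (structc e i j k) 0.
  by rewrite mul0r.
by rewrite [X in _ * X]/structc eij linearZ /= coord_nth // kk' !mulr0.
Qed.

(** As a function of the label, the structure constant is up to sign the contraction of de^k with
    e_i, which niceness makes a multiple of one dual basis element. *)
Lemma structc_label i j j' k : j != j' ->
  structc e i j k * structc e i j' k = 0.
Proof.
move=> jj'; case: e_nice => _ _ /(_ i k)[l [c ek]].
have cE h : structc e i h k = - (c * (h == l)%:R).
  by rewrite -(coord_nth l h e_basis) -ek opprK.
rewrite !cE; have [jl | _] := eqVneq j l; last by rewrite mulr0 oppr0 mul0r.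
by rewrite -jl eq_sym (negPf jj') mulr0 oppr0 mulr0.
Qed.

(** If neither factor vanished, bracketing with e_i and then with e_j would bring e_k back to a
    nonzero multiple of itself. *)
Lemma structc_cycle i j k l : structc e i k l * structc e j l k = 0.
Proof.
apply: contraTeq (nth_basis_neq0 k) => ikl; rewrite negbK.
have := ikl; rewrite mulf_eq0 negb_or => /andP[ci cj].
exact/eqP/(nilpotent_no_cycle g_nilpotent (lie_structc ci) (lie_structc cj)).
Qed.

Lemma structc_fix i j : structc e i j j = 0.
Proof.
by have /eqP := structc_cycle i i j j; rewrite mulf_eq0 orbb => /eqP.
Qed.

Variable eps : 'cV[R]_n.
Hypothesis eps2 : forall i, eps i 0 * eps i 0 = 1.
Let m : {symmetric g} := diag_metric e eps.
Let m0 : nondegenerate m := diag_metric_nondeg e_basis eps2.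

Lemma levi_civita_coord (a b c : 'I_n) :
  coord e c (levi_civita m e`_a e`_b) =
    2^-1 * (structc e a b c - eps c 0 * eps a 0 * structc e b c a
            + eps c 0 * eps b 0 * structc e c a b).
Proof.
rewrite (diag_metric_coord e_basis eps2) koszulP // !diag_metric_nth //.
rewrite -!/(structc e _ _ _) mulrCA; congr (_ * _).
rewrite !mulrDr mulrN !mulrA eps2 mul1r; ring.
Qed.

(** The e_a-coefficient of nabla_{e_a} e_b involves only c_{aba}, c_{baa} and c_{aab}; the first two
    vanish by nilpotency, the last because the bracket is alternating. *)
Lemma lftr_levi_civita w : lftr (linfun (fun x => levi_civita m x w)) = 0.
Proof.
rewrite (lftr_coord _ e_basis) big1 // => a _.
rewrite linfunE; last exact: levi_civita_linear_l.
rewrite (coord_basis e_basis (memvf w)).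
have lcE := linfunE (levi_civita_linear_r e`_a m0).
rewrite -lcE !linear_sum big1 // => b _.
rewrite !linearZ /= lcE levi_civita_coord eps2 mul1r structc_fix.
by rewrite (structcC b a) structc_fix /structc liexx linear0; ring.
Qed.

Lemma nice_ricci_form (b d : 'I_n) :
  ricci_form m e`_b e`_d = \sum_a \sum_c
    (4^-1 * (eps a 0 * eps c 0 * eps b 0 * eps d 0
             * (structc e a c b * structc e a c d))
     - 2^-1 * (eps a 0 * eps c 0 * (structc e b a c * structc e d a c))).
Proof.
rewrite (ricci_form_trace two0) //; last exact: lftr_levi_civita.
rewrite (lftr_coord _ e_basis) -sumrN.
pose P (x a c : 'I_n) := structc e x a c.
(* [F] is the difference of the two summands, modulo [structc_cycle]. *)
pose F (a c : 'I_n) := 4^-1 * (eps a 0 * eps d 0 * P a c d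
                     * (P b a c + eps a 0 * eps c 0 * P b c a)
                   - eps a 0 * eps b 0 * P a c b
                     * (P d a c + eps a 0 * eps c 0 * P d c a)
                   + eps a 0 * eps c 0
                     * (P b a c * P d a c - P b c a * P d c a)).
have FN a c : F c a = - F a c.
  rewrite /F /P !(structcC a c).
  have := eps2 a; have := eps2 c.
  move: (eps a 0) (eps c 0) => x y y2 x2.
  ring: x2 y2.
(* The two double sums agree only as wholes. Adding the vanishing sum of the antisymmetric [F] turns
   the claim into an equality for each pair (a, c). *)
rewrite -[RHS]addr0 -[X in _ = _ + X](sum_antisym two0 FN) -big_split /=.
apply: eq_bigr => a _; rewrite -big_split /=.
have lcE w := linfunE (levi_civita_linear_l w m0).
rewrite comp_lfunE !lcE.
rewrite (coord_basis e_basis (memvf (levi_civita m e`_a e`_b))).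
rewrite -lcE !linear_sum -sumrN; apply: eq_bigr => c _.
rewrite !linearZ /= lcE !levi_civita_coord /F /P.
(* With every coefficient expressed through [2^-1 * 2^-1], the identity becomes polynomial. *)
have quarter : 4^-1 = 2^-1 * 2^-1 :> R by rewrite -invfM -natrM.
have half : 2^-1 = 2 * (2^-1 * 2^-1) :> R by rewrite mulrA divff // mul1r.
rewrite [in RHS]half quarter.
rewrite (structcC b a) (structcC d c) (structcC a c).
(* These are the summands of the Killing form of e_b and e_d. *)
have := structc_cycle d b a c; have := structc_cycle b d a c.
have := eps2 c; have := eps2 a.
move: (eps a 0) (eps c 0) (structc e b a c) (structc e d a c)
  (structc e b c a) (structc e d c a) => x y p q p' q' x2 y2 pq' qp'.
ring: x2 y2 pq' qp'.
Qed.

(** Off the diagonal each niceness condition kills one of the two terms of [nice_ricci_form]: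
    [structc_target] the first, [structc_label] the second. *)
Lemma nice_ricci (b : 'I_n) : ricci m e`_b =
  (\sum_a \sum_c
    (4^-1 * (eps a 0 * eps c 0 * eps b 0 * structc e a c b ^+ 2)
     - 2^-1 * (eps b 0 * eps a 0 * eps c 0 * structc e b a c ^+ 2))) *: e`_b.
Proof.
rewrite (coord_basis e_basis (memvf (ricci m e`_b))) (bigD1 b) //= big1.
  rewrite addr0 (diag_metric_coord e_basis eps2) ricciP // nice_ricci_form.
  rewrite mulr_sumr; congr (_ *: _); apply: eq_bigr => a _.
  rewrite mulr_sumr; apply: eq_bigr => c _.
  rewrite -[eps a 0 * eps c 0 * eps b 0 * eps b 0]mulrA eps2; ring.
move=> d db; rewrite (diag_metric_coord e_basis eps2) ricciP // nice_ricci_form.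
rewrite big1 ?mulr0 ?scale0r // => a _; rewrite big1 // => c _.
rewrite structc_target; last by rewrite eq_sym.
rewrite (structcC a b) (structcC a d) mulrNN structc_label ?mulr0 ?subrr //.
by rewrite eq_sym.
Qed.
End NiceRicci.

(** * The Ricci operator through the root matrix *)

Section RootMatrix.
Variables (R : realFieldType) (g : lieAlgType R) (n : nat) (e : n.-tuple g).
Hypothesis g_nilpotent : lie_nilpotent g.
Hypothesis e_nice : nice_basis e.
Let Delta := nice_diagram e.

Lemma nice_diagramE i j k :
  ((i, j, k) \in Delta) = (structc e i j k != 0).
Proof.
rewrite inE; case: eqVneq => //= cijk.
by apply/eqP/lie_structc.
Qed.

Lemma structc_distinct i j k : structc e i j k != 0 ->
  [/\ i != j, k != i & k != j].
Proof.
move=> cijk; split; apply: contraNneq cijk => eq_ij.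
- by rewrite eq_ij /structc liexx linear0.
- by rewrite eq_ij structcC (structc_fix g_nilpotent e_nice) oppr0.
- by rewrite eq_ij (structc_fix g_nilpotent e_nice).
Qed.

(** The nested conditionals of [root_int] agree with this sum of indicators because the three nodes
    of an arrow are distinct. *)
Lemma root_matrixE (K : pzRingType) (I : 'I_#|root_rows Delta|) (l : 'I_n) :
  root_matrix K Delta I l =
    (l == (root_arrow I).2)%:R - (l == (root_arrow I).1.1)%:R
    - (l == (root_arrow I).1.2)%:R.
Proof.
rewrite !mxE; have := enum_valP I; rewrite -/(root_arrow I) inE.
case: (root_arrow I) => [[i j] k] /= /andP[]; rewrite nice_diagramE.
move=> /structc_distinct[ij ki kj] _.
have [->|li] := eqVneq l i.
  by rewrite /= eq_sym (negPf ki) (negPf ij) rmorphN1 sub0r subr0.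
have [->|lj] := eqVneq l j.
  by rewrite /= eq_sym (negPf kj) rmorphN1 subr0 sub0r.
by rewrite !subr0 /=; case: (l == k); rewrite ?rmorph1 ?rmorph0.
Qed.

Lemma mul_root_matrix (K : pzRingType) (v : 'cV[K]_n) I :
  (root_matrix K Delta *m v) I 0 =
    v (root_arrow I).2 0 - v (root_arrow I).1.1 0 - v (root_arrow I).1.2 0.
Proof.
have pick (j : 'I_n) : \sum_l (l == j)%:R * v l 0 = v j 0.
  rewrite (bigD1 j) //= big1 => [|l /negPf lj].
    by rewrite eqxx mul1r addr0.
  by rewrite lj mul0r.
rewrite mxE -!pick -!sumrB; apply: eq_bigr => l _.
by rewrite root_matrixE !mulrBl.
Qed.

(** Row I of the equation over F_2, where minus is plus, gives x_I the sign eps_i eps_j eps_k, while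
    c_I^2 is its absolute value; the eight sign patterns are checked in turn. *)
Lemma sign_root_row (eps : 'cV[R]_n) (X : 'cV[R]_#|root_rows Delta|)
    (I : 'I_#|root_rows Delta|) :
  (forall i, eps i 0 = 1 \/ eps i 0 = -1) ->
  root_matrix2 Delta *m map_mx (@logsign R) eps = map_mx (@logsign R) X ->
  row_structc e I ^+ 2 = `|X I 0| ->
  X I 0 = eps (root_arrow I).1.1 0 * eps (root_arrow I).1.2 0
          * eps (root_arrow I).2 0 * row_structc e I ^+ 2.
Proof.
move=> eps1 /matrixP/(_ I 0); rewrite mul_root_matrix !mxE => sgn ->.
have lsP i : logsign (eps i 0) = 0 /\ eps i 0 = 1 \/
             logsign (eps i 0) = 1 /\ eps i 0 = -1.
  by case: (eps1 i) => ->; [left | right]; rewrite /logsign ?ltrN10 ?ltr10.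
move: sgn.
have [[-> ->]|[-> ->]] := lsP (root_arrow I).1.1;
  have [[-> ->]|[-> ->]] := lsP (root_arrow I).1.2;
  have [[-> ->]|[-> ->]] := lsP (root_arrow I).2;
  rewrite /logsign; case: ltP => X0 /eqP // _;
  rewrite ?(ltr0_norm X0) ?(ger0_norm X0);
  by rewrite ?(mul1r, mulr1, mulN1r, mulrN1, opprK).
Qed.

(** By the symmetry of [y], the sum over rows is half a sum over all triples (i, j, k). The entry +1
    at k gives the first double sum; the entries -1 at i and j give two equal halves of the
    second. *)
Lemma tr_mul_root_matrix (X : 'cV[R]_#|root_rows Delta|)
    (y : 'I_n -> 'I_n -> 'I_n -> R) b :
  (forall I,
    X I 0 = y (root_arrow I).1.1 (root_arrow I).1.2 (root_arrow I).2) ->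
  (forall i j k, y j i k = y i j k) ->
  (forall i j k, structc e i j k = 0 -> y i j k = 0) ->
  ((root_matrix R Delta)^T *m X) b 0 =
    2^-1 * (\sum_a \sum_c y a c b) - \sum_a \sum_c y b a c.
Proof.
move=> Xy yC y0; rewrite mxE.
pose w (i j k : 'I_n) : R :=
  ((b == k)%:R - (b == i)%:R - (b == j)%:R) * y i j k.
have wC i j k : w j i k = w i j k by rewrite /w yC addrAC.
have w0 i j k : structc e i j k = 0 -> w i j k = 0.
  by move=> /y0; rewrite /w => ->; rewrite mulr0.
pose S := \sum_i \sum_j \sum_k w i j k.
transitivity (2^-1 * S).
  transitivity (\sum_(t in root_rows Delta) w t.1.1 t.1.2 t.2).
    rewrite [RHS]big_enum_val; apply: eq_bigr => I _.
    by rewrite mxE root_matrixE Xy.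
  transitivity (\sum_(t : arrow n | (t.1.1 < t.1.2)%N) w t.1.1 t.1.2 t.2).
    rewrite big_mkcond [RHS]big_mkcond; apply: eq_bigr => -[[i j] k] _ /=.
    rewrite inE nice_diagramE /=; case: eqVneq => //= /w0 ->.
    by case: ltnP.
  set T := LHS.
  (* The swap of i and j exchanges the triples with i < j and those with i > j; triples with i = j
     contribute nothing since [e_i, e_i] = 0. *)
  have -> : S = T + T.
    rewrite /S pair_bigA pair_bigA /=.
    rewrite (bigID (fun t : arrow n => t.1.1 < t.1.2)%N) /=.
    congr (_ + _).
    rewrite (reindex_inj (inv_inj (f := fun t : arrow n =>
      (t.1.2, t.1.1, t.2)) _)) => [|[[]]] //=.
    rewrite big_mkcond [RHS]big_mkcond; apply: eq_bigr => -[[i j] k] _ /=.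
    rewrite wC; case: ltngtP => //= /val_inj ->.
    by apply: w0; rewrite /structc liexx linear0.
  by rewrite -mulr2n -[T *+ 2]mulr_natl mulKf ?pnatr_eq0.
have pick (F : 'I_n -> R) : \sum_k (b == k)%:R * F k = F b.
  rewrite (bigD1 b) //= big1 => [|k /negPf kb].
    by rewrite eqxx mul1r addr0.
  by rewrite eq_sym kb mul0r.
have -> : S = \sum_a \sum_c y a c b - 2 * (\sum_a \sum_c y b a c).
  rewrite mulr_natl mulr2n opprD addrA.
  rewrite -{1}(pick (fun i => \sum_a \sum_c y i a c)).
  rewrite -!sumrB; apply: eq_bigr => i _.
  under [X in _ = _ - X]eq_bigr => c _ do rewrite yC.
  rewrite -(pick (fun j => \sum_k y i j k)) [X in _ - X - _]mulr_sumr -!sumrB.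
  apply: eq_bigr => j _; rewrite -(pick (y i j)) !mulr_sumr -!sumrB.
  by apply: eq_bigr => k _; rewrite /w !mulrBl.
by rewrite mulrBr mulKf ?pnatr_eq0.
Qed.
Lemma nice_ricci_root_matrix (eps : 'cV[R]_n) (X : 'cV[R]_#|root_rows Delta|) :
  (forall i, eps i 0 = 1 \/ eps i 0 = -1) ->
  root_matrix2 Delta *m map_mx (@logsign R) eps = map_mx (@logsign R) X ->
  (forall I : 'I_#|root_rows Delta|, row_structc e I ^+ 2 = `|X I 0|) ->
  ricci (diag_metric e eps : {symmetric g}) =
    endo_of e (diag_mx (2^-1 *: ((root_matrix R Delta)^T *m X)^T)).
Proof.
move=> eps1 X_sign X_abs.
have e_basis : basis_of {:g} e by case: e_nice.
have two0 : (2 : R) != 0 by rewrite pnatr_eq0.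
have eps2 i : eps i 0 * eps i 0 = 1.
  by case: (eps1 i) => ->; rewrite ?mulrNN mulr1.
apply: (lfun_basisP e_basis) => b.
rewrite nice_ricci // endo_ofE // [RHS](bigD1 b) //= [X in _ + X]big1;
  last first.
  by move=> i /negPf ib; rewrite !mxE ib mulr0n scale0r.
rewrite addr0; congr (_ *: _).
rewrite [RHS]mxE eqxx mulr1n [RHS]mxE [X in _ * X]mxE.
(* This extends X from the rows to all triples of nodes, and makes the entries of [nice_ricci] those
   of [tr_mul_root_matrix] up to the factor 1/2. *)
pose z i j k := eps i 0 * eps j 0 * eps k 0 * structc e i j k ^+ 2.
have -> := tr_mul_root_matrix (y := z).
- rewrite mulrBr mulrA -invfM -natrM !mulr_sumr -sumrB.
  apply: eq_bigr => i _; rewrite !mulr_sumr -sumrB.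
  by apply: eq_bigr => j _; rewrite /z !mulrA.
- move=> I; rewrite (sign_root_row eps1 X_sign (X_abs I)).
  by rewrite /row_structc; case: (root_arrow I) => [[]].
- by move=> i j k; rewrite /z structcC sqrrN [eps j 0 * _]mulrC.
- by move=> i j k; rewrite /z => ->; rewrite expr0n mulr0.
Qed.
End RootMatrix.

(** * Matrix algebra of a diagonal plus a matching *)

Section Matching.
Variables (R : fieldType) (n : nat) (calA : {set 'I_n * 'I_n}).
Hypothesis calA_irrefl : forall i j, (i, j) \in calA -> i != j.
Hypothesis calA_disjoint : forall i j i' j', (i, j) \in calA ->
  (i', j') \in calA -> (i, j) <> (i', j') -> uniq [:: i; j; i'; j'].

(** The shape of the off-diagonal part N of D; [calA_tr] has the transposed shape, that of its
    metric adjoint. *)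
Definition calA_mx (x : 'I_n * 'I_n -> R) : 'M[R]_n :=
  \sum_(p in calA) x p *: dyad R p.1 p.2.
Definition calA_tr (x : 'I_n * 'I_n -> R) : 'M[R]_n :=
  \sum_(p in calA) x p *: dyad R p.2 p.1.

(** All that the products below need from (N1), which settles p = q, and (N2), which settles p !=
    q. *)
Lemma calA_neq p q : p \in calA -> q \in calA ->
  (p.1 == q.2) = false /\ (p != q -> p.1 != q.1 /\ p.2 != q.2).
Proof.
case: p q => [i j] [i' j'] /= pA qA.
have [[-> ->]|pq] := eqVneq (i, j) (i', j').
  by rewrite (negPf (calA_irrefl qA)).
have := calA_disjoint pA qA (elimN eqP pq); rewrite /= !inE !negb_or.
by case/and4P=> /and3P[_ ii /negPf ->] /andP[_ ->] _ _; rewrite ii.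
Qed.

(** Since [dyad R i j] has its entry in row j and column i, [r] and [c] pick rows and columns, and
    two dyads compose only when an inner column meets an inner row. *)
Lemma mul_sum_dyad (x y : 'I_n * 'I_n -> R) (r c r' c' : 'I_n * 'I_n -> 'I_n) :
  (\sum_(p in calA) x p *: dyad R (c p) (r p))
    *m (\sum_(q in calA) y q *: dyad R (c' q) (r' q)) =
  \sum_(p in calA) \sum_(q in calA)
    (x p * y q) *: (delta_mx (r p) (c' q) *+ (c p == r' q)).
Proof.
rewrite mulmx_suml; apply: eq_bigr => p _; rewrite mulmx_sumr.
apply: eq_bigr => q _.
by rewrite -scalemxAl -scalemxAr scalerA mul_delta_mx_cond.
Qed.

Lemma mul_calA_mx (x y : 'I_n * 'I_n -> R) : calA_mx x *m calA_mx y = 0.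
Proof.
rewrite mul_sum_dyad big1 // => p pA; rewrite big1 // => q qA.
by have [-> _] := calA_neq pA qA; rewrite scaler0.
Qed.

Lemma mul_calA_tr (x y : 'I_n * 'I_n -> R) : calA_tr x *m calA_tr y = 0.
Proof.
rewrite mul_sum_dyad big1 // => p pA; rewrite big1 // => q qA.
by rewrite eq_sym; have [-> _] := calA_neq qA pA; rewrite scaler0.
Qed.

Lemma mul_calA_mx_tr (x y : 'I_n * 'I_n -> R) :
  calA_mx x *m calA_tr y = \sum_(p in calA) (x p * y p) *: dyad R p.2 p.2.
Proof.
rewrite mul_sum_dyad; apply: eq_bigr => p pA; rewrite (bigD1 p) //= big1.
  by rewrite eqxx addr0.
move=> q /andP[qA qp]; have [_ /(_ qp)[/negPf pq _]] := calA_neq qA pA.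
by rewrite eq_sym pq scaler0.
Qed.

Lemma mul_calA_tr_mx (x y : 'I_n * 'I_n -> R) :
  calA_tr y *m calA_mx x = \sum_(p in calA) (x p * y p) *: dyad R p.1 p.1.
Proof.
rewrite mul_sum_dyad; apply: eq_bigr => p pA; rewrite (bigD1 p) //= big1.
  by rewrite eqxx addr0 mulrC.
move=> q /andP[qA qp]; have [_ /(_ qp)[_ /negPf pq]] := calA_neq qA pA.
by rewrite eq_sym pq scaler0.
Qed.

Variables (l : 'rV[R]_n) (t : R) (x y : 'I_n * 'I_n -> R).
Hypothesis weight : forall i j, (i, j) \in calA -> t = l 0 i - l 0 j.
Let N := calA_mx x.
Let N' := calA_tr y.
Let D := diag_mx l + N.
Let D' := diag_mx l + N'.

Lemma diag_mx_dyad i j :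
  diag_mx l *m dyad R i j = l 0 j *: dyad R i j /\
  dyad R i j *m diag_mx l = l 0 i *: dyad R i j.
Proof.
split; apply/matrixP => u v; rewrite ?mul_diag_mx ?mul_mx_diag !mxE.
  by have [->|_] := eqVneq u j; rewrite ?mulr0.
by have [->|_] := eqVneq v i; rewrite ?andbF ?mulr0 ?mul0r // mulrC.
Qed.

(** Commuting with a diagonal matrix scales the dyad of (i, j) by l_i - l_j, and (N5) makes this the
    same number [t] for every pair. *)
Lemma calA_mx_comm_diag : N *m diag_mx l - diag_mx l *m N = t *: N.
Proof.
rewrite mulmx_suml mulmx_sumr -sumrB scaler_sumr.
apply: eq_bigr => -[i j] /= /weight ->; have [Ll Lr] := diag_mx_dyad i j.
by rewrite -scalemxAl -scalemxAr Ll Lr !scalerA -scalerBl -mulrBr mulrC.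
Qed.

Lemma calA_tr_comm_diag : diag_mx l *m N' - N' *m diag_mx l = t *: N'.
Proof.
rewrite mulmx_suml mulmx_sumr -sumrB scaler_sumr.
apply: eq_bigr => -[i j] /= /weight ->; have [Ll Lr] := diag_mx_dyad j i.
by rewrite -scalemxAl -scalemxAr Ll Lr !scalerA -scalerBl -mulrBr mulrC.
Qed.

(** With L = [diag_mx l], the commutator is [N, L] + [L, N'] + [N, N']; the last bracket is diagonal
    because distinct pairs are disjoint. *)
Lemma matching_comm : D *m D' - D' *m D = t *: (N + N')
  + \sum_(p in calA) (x p * y p) *: (dyad R p.2 p.2 - dyad R p.1 p.1).
Proof.
under eq_bigr do rewrite scalerBr.
rewrite sumrB -mul_calA_mx_tr -mul_calA_tr_mx -/N -/N' scalerDr.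
rewrite -calA_mx_comm_diag -calA_tr_comm_diag /D /D' !mulmxDl !mulmxDr.
move: (_ *m _) (N *m diag_mx l) (diag_mx l *m N) (N *m N') (N' *m N)
  (diag_mx l *m N') (N' *m diag_mx l) => L2 a1 a2 a3 a4 a5 a6.
apply/matrixP => i j; rewrite !mxE; ring.
Qed.

(** In the square of 2 L + N + N', the products of L with N or N' are trace-free and N, N' square to
    zero. *)
Lemma mxtrace_matching : \tr ((D + D') *m (D + D')) =
  4 * \sum_i l 0 i ^+ 2 + 2 * \sum_(p in calA) x p * y p.
Proof.
have tr_dyad (i j : 'I_n) : \tr (dyad R i j) = (i == j)%:R.
  rewrite /mxtrace (bigD1 j) //= big1 => [|k /negPf kj]; last by rewrite mxE kj.
  by rewrite mxE eqxx addr0 eq_sym.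
have trL z (r c : 'I_n * 'I_n -> 'I_n) :
    (forall p, p \in calA -> r p != c p) ->
    \tr (diag_mx l *m \sum_(p in calA) z p *: dyad R (r p) (c p)) = 0.
  move=> rc; rewrite mulmx_sumr raddf_sum big1 // => p /rc /negPf pA.
  rewrite -scalemxAr; have [-> _] := diag_mx_dyad (r p) (c p).
  by rewrite /= !mxtraceZ tr_dyad pA !mulr0.
have trN : \tr (diag_mx l *m N) = 0.
  by apply: trL => -[i j]; apply: calA_irrefl.
have trN' : \tr (diag_mx l *m N') = 0.
  by apply: trL => -[i j] /calA_irrefl; rewrite eq_sym.
have trNN' : \tr (N *m N') = \sum_(p in calA) x p * y p.
  rewrite mul_calA_mx_tr raddf_sum; apply: eq_bigr => p _ /=.
  by rewrite mxtraceZ tr_dyad eqxx mulr1.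
have trL2 : \tr (diag_mx l *m diag_mx l) = \sum_i l 0 i ^+ 2.
  by apply: eq_bigr => i _; rewrite mul_diag_mx !mxE eqxx mulr1n expr2.
rewrite /D /D' !mulmxDl !mulmxDr mul_calA_mx mul_calA_tr !mxtraceD mxtrace0.
rewrite (mxtrace_mulC N (diag_mx l)) (mxtrace_mulC N' (diag_mx l)).
rewrite (mxtrace_mulC N' N) trN trN' trNN' trL2; ring.
Qed.
End Matching.

(** * Both identities, read as matrix identities in the nice basis *)

Theorem theorem2p7 (R : realType) (n : nat) (Delta : {set arrow n})
    (calA : {set 'I_n * 'I_n}) (D : 'M[R]_n) (A : 'I_n -> 'I_n -> R)
    (X : 'cV[R]_#|root_rows Delta|) (eps : 'cV[R]_n)
    (g : lieAlgType R) (e : n.-tuple g) :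
  is_nice_diagram R Delta ->
  nondiagonal_triple Delta calA D A ->
  (2 * \tr D)^-1 *: ((root_matrix R Delta)^T *m X) =
    const_mx (- 1 - \sum_(p in calA) A p.1 p.2)
    + \sum_(p in calA) A p.1 p.2 *: (delta_mx p.1 0 - delta_mx p.2 0)
    + diagonal D ->
  (forall i, eps i 0 = 1 \/ eps i 0 = -1) ->
  root_matrix2 Delta *m map_mx (@logsign R) eps = map_mx (@logsign R) X ->
  (forall i j, (i, j) \in calA ->
    eps i 0 / eps j 0 = Num.sg (A i j * \tr D)) ->
  lie_nilpotent g ->
  nice_basis e ->
  nice_diagram e = Delta ->
  (forall I : 'I_#|root_rows Delta|, row_structc e I ^+ 2 = `|X I 0|) ->
  is_derivation (endo_of e D) ->
  let m : {symmetric g} := diag_metric e eps in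
  let f : 'End(g) := endo_of e D in
  let fs : 'End(g) := sympart m f in
  ricci m = - lftr (fs \o fs)%VF *: \1%VF - 2^-1 *: lfcomm f (adjoint m f)
            + lftr f *: fs
  /\ forall v : g, lftr (ad v \o adjoint m f)%VF = 0.
Proof.
move=> _ triple X_eq eps1 X_sign eps_sign g_nil e_nice defDelta X_abs _ m f fs.
subst Delta.
have [A_nonempty _ irr dis noarrow kerD weight [a [shape a2 lker]]] := triple.
have e_basis : basis_of {:g} e by case: e_nice.
have two0 : (2 : R) != 0 by rewrite pnatr_eq0.
have eps2 i : eps i 0 * eps i 0 = 1.
  by case: (eps1 i) => ->; rewrite ?mulrNN mulr1.
pose t := \tr D; pose l := (diagonal D)^T; pose c := \sum_(p in calA) A p.1 p.2.
pose x (p : 'I_n * 'I_n) := a p.2 p.1.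
pose y (p : 'I_n * 'I_n) := eps p.1 0 * eps p.2 0 * x p.
have lE i : diagonal D i 0 = l 0 i by rewrite [RHS]mxE.
have tE : t = \sum_i l 0 i by apply: eq_bigr => i _; rewrite !mxE.
have t0 : t != 0.
  have [[i j] /a2[_]] := set0Pn _ A_nonempty.
  by rewrite normr_eq0 mulf_eq0 negb_or => /andP[].
have weight_l i j : (i, j) \in calA -> t = l 0 i - l 0 j.
  by move=> /weight; rewrite tE !lE => <-; apply: eq_bigr => k _; rewrite lE.
have defD : D = diag_mx l + calA_mx calA x.
  rewrite [LHS]shape; congr (_ + _); rewrite diag_mx_sum_delta.
  by apply: eq_bigr => i _; rewrite lE.
have defD' : adjoint_mx eps D = diag_mx l + calA_tr calA y.
  apply/matrixP => i j; rewrite {1}defD !mxE !summxE mulrDr mulr_sumr.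
  congr (_ + _).
    have [->|] := eqVneq i j; first by rewrite eps2 mul1r.
    by rewrite !mulr0n mulr0.
  apply: eq_bigr => p _; rewrite !mxE.
  have [->|_] := eqVneq j p.2; last by rewrite andbF !mulr0.
  by have [->|_] := eqVneq i p.1; rewrite ?mulr0 ?mulr1.
(* The product is eps_i / eps_j times a_{ji}^2, that is the sign of A t times |2 A t|; this is where
   the sign condition on [eps] enters. *)
have xy p : p \in calA -> x p * y p = 2 * A p.1 p.2 * t.
  case: p => i j /[dup] /a2[xsq _] /eps_sign /= eps_ij.
  have -> : x (i, j) * y (i, j) = eps i 0 / eps j 0 * a j i ^+ 2.
    rewrite /y /x /=; have -> : (eps j 0)^-1 = eps j 0.
      by case: (eps1 j) => ->; rewrite ?invrN invr1.
    ring.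
  rewrite eps_ij xsq -mulrA normrM (ger0_norm (ler0n R 2)) mulrCA.
  by rewrite -numEsg !mulrA.
have sum_xy : \sum_(p in calA) x p * y p = 2 * t * c.
  by rewrite mulr_sumr; apply: eq_bigr => p /xy ->; ring.
(* In (N4) at mu = lambda, (N5) turns every lambda_j - lambda_i into -t, so the right side is (1 +
   c) t - c t. *)
have l_sq : \sum_i l 0 i ^+ 2 = t.
  have := kerD _ lker; rewrite -/c.
  under eq_bigr do rewrite lE -expr2.
  under [X in _ * X + _]eq_bigr do rewrite lE.
  rewrite -tE => ->.
  rewrite (eq_bigr (fun p => - (t * A p.1 p.2))) => [|[i j] /weight_l pA /=].
    by rewrite sumrN -mulr_sumr -/c; ring.
  by rewrite !lE {1}pA; ring.
have adjf : adjoint m f = endo_of e (adjoint_mx eps D).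
  exact: adjoint_endo_of.
split.
  pose S := 2^-1 *: (D + adjoint_mx eps D).
  have fsE : fs = endo_of e S.
    by rewrite /fs /sympart adjf linearZ (linearD (endo_of e)).
  rewrite (nice_ricci_root_matrix g_nil e_nice eps1 X_sign X_abs).
  rewrite /lfcomm adjf fsE /f -!endo_of_mul // -(endo_of1 e_basis).
  rewrite !lftr_endo_of //.
  have endoZ k B : k *: endo_of e B = endo_of e (k *: B) by rewrite linearZ.
  rewrite -linearB !endoZ -linearB -linearD; congr (endo_of e _).
  (* The hypothesis on X multiplied by t, with the vectors e_i - e_j read as diagonal matrices. *)
  have rE : diag_mx (2^-1 *: ((root_matrix R (nice_diagram e))^T *m X)^T) =
      t *: ((-1 - c) *: 1%:M + diag_mx l
      - \sum_(p in calA) A p.1 p.2 *: (dyad R p.2 p.2 - dyad R p.1 p.1)).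
    have MX : (root_matrix R (nice_diagram e))^T *m X = (2 * t) *:
        (const_mx (- 1 - c) + \sum_(p in calA) A p.1 p.2 *:
          (delta_mx p.1 0 - delta_mx p.2 0) + diagonal D).
      by rewrite -X_eq scalerA divff ?scale1r // mulf_neq0.
    rewrite MX; apply/matrixP => i j; rewrite !mxE !summxE.
    have [-> | ij] := eqVneq i j.
      rewrite !mulr1n mulr1 -mulrA mulKf // addrAC; congr (_ * (_ + _)).
      rewrite -sumrN; apply: eq_bigr => p _.
      by rewrite !mxE !andbb !andbT; ring.
    have off k : (i == k) && (j == k) = false.
      by apply: contraNF ij => /andP[/eqP -> /eqP ->].
    rewrite !mulr0n mulr0 addr0 add0r big1 ?oppr0 ?mulr0 // => p _.
    by rewrite !mxE !off subrr mulr0.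
  have half : 2^-1 * 2^-1 = 4^-1 :> R by rewrite -invfM -natrM.
  rewrite rE /S -scalemxAl -scalemxAr scalerA half mxtraceZ -/t.
  rewrite defD' defD.
  (* Now tr (S^2) = (4 t + 4 t c) / 4 = t (1 + c), and the term t/2 (N + N') of t S cancels against
     that of the commutator. *)
  rewrite (mxtrace_matching irr dis) (matching_comm irr dis x y weight_l).
  rewrite l_sq sum_xy.
  have -> :
      \sum_(p in calA) (x p * y p) *: (dyad R p.2 p.2 - dyad R p.1 p.1) =
      (2 * t) *: \sum_(p in calA)
        A p.1 p.2 *: (dyad R p.2 p.2 - dyad R p.1 p.1).
    rewrite scaler_sumr; apply: eq_bigr => p /xy ->.
    by rewrite scalerA mulrAC.
  move: (\sum_(p in calA) _ *: _) (calA_mx _ _) (calA_tr _ _) => T N N'.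
  by apply/matrixP => i j; rewrite !mxE; field.
move=> v; rewrite adjf (lftr_coord _ e_basis) big1 // => i _.
rewrite comp_lfunE adE endo_ofE // (coord_basis e_basis (memvf v)).
rewrite linear_sumlz linear_sum big1 // => k _.
rewrite linear_sumr linear_sum big1 // => j _.
rewrite linearZl_LR linearZr_LR !linearZ /= -/(structc e k j i).
(* The trace is a sum of terms v_k c_{kji} times the entry (j, i) of the adjoint. For j != i that
   entry requires (j, i) in [calA], whereas c_{kji} != 0 gives an arrow from j to i with label k,
   against (N3). *)
have [-> | ij] := eqVneq j i; first by rewrite structc_fix // !mulr0.
have [-> | ] := eqVneq (structc e k j i) 0; first by rewrite !mulr0.
rewrite structcC oppr_eq0 -nice_diagramE // => jki.
rewrite defD' !mxE (negPf ij) mulr0n add0r summxE big1 ?mul0r ?mulr0 // => p pA.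
rewrite !mxE; have [jp|_] := eqVneq j p.1; last by rewrite mulr0.
have [ip|_] := eqVneq i p.2; last by rewrite mulr0.
have := @noarrow p.1 p.2; rewrite -surjective_pairing => /(_ pA k).
by rewrite -jp -ip jki.
Qed.
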